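(* Suppose $(A,B)$ is controllable, $w^d=\mathrm{col}(u^d,x^d)$ is a trajectory of length $T_d$ of the network system $x(t+1)=Ax(t)+Bu(t)$, and either (i) $u^d$ is persistently exciting of order $n+\tau$; or (ii) $\mathrm{col}(u_i^d,x^d_{\mathcal{N}_i})$ is persistently exciting of order $n_i+\tau$ for each $i\in S$, and $x^d_{\mathcal{N}_i}$ is persistently exciting of order $n_i+\tau$ for each $i\in\mathcal{V}\setminus S$. Then for every trajectory $w=\mathrm{col}(u,x)$ of length $\tau$ of the network system, for all $i\in\mathcal{V}$ there exists $g_i\in\mathbb{R}^{T_d-\tau+1}$ such that $\mathcal{H}_\tau(w_i^d)\,g_i=w_i$.
   Context: Notation: $[a,b]=\{a,a+1,\dots,b\}$ for integers $a<b$. $\mathrm{col}$ denotes vertical stacking of vectors; for signals defined on the same time interval, $\mathrm{col}(v_1,v_2)(t)=\mathrm{col}(v_1(t),v_2(t))$. A signal $w:[0,\tau-1]\to\mathbb{R}^k$ is identified with the vector $\mathrm{col}(w(0),\dots,w(\tau-1))\in\mathbb{R}^{k\tau}$. For a signal $w:[0,T_d-1]\to\mathbb{R}^k$ and $\tau\le T_d$, the Hankel matrix with $\tau$ block rows, $\mathcal{H}_\tau(w)\in\mathbb{R}^{k\tau\times(T_d-\tau+1)}$, has $(a,b)$ block entry $w(a+b)$, $a\in[0,\tau-1]$, $b\in[0,T_d-\tau]$. A signal $w:[0,T_d-1]\to\mathbb{R}^k$ is persistently exciting of order $t$ (with $t<T_d$) if $\mathcal{H}_t(w)$ has row rank $kt$.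 Network system: $\mathcal{G}=(\mathcal{V},\mathcal{E})$ is an undirected graph with $\mathcal{V}=[1,N]$, $\mathcal{N}_i=\{j:(i,j)\in\mathcal{E}\}$ are the neighbors of $i$, and $S\subset\mathcal{V}$ is the set of actuated nodes. Node $i$ has state $x_i\in\mathbb{R}^{n_i}$ and, if $i\in S$, input $u_i\in\mathbb{R}^{m_i}$. The dynamics are $$x_i(t+1)=A_{ii}x_i(t)+\sum_{j\in\mathcal{N}_i}A_{ij}x_j(t)+B_iu_i(t)\ (i\in S),\qquad x_i(t+1)=A_{ii}x_i(t)+\sum_{j\in\mathcal{N}_i}A_{ij}x_j(t)\ (i\notin S),$$ with $A_{ij}\in\mathbb{R}^{n_i\times n_j}$, $B_i\in\mathbb{R}^{n_i\times m_i}$. Let $x=\mathrm{col}(x_1,\dots,x_N)\in\mathbb{R}^n$, $n=\sum_{i\in\mathcal V} n_i$; let $u\in\mathbb{R}^m$, $m=\sum_{i\in S}m_i$, be the stack of the $u_i$, $i\in S$; in compact form the dynamics read $x(t+1)=Ax(t)+Bu(t)$. A signal $\mathrm{col}(u,x)$ on $[0,L-1]$ is a trajectory of length $L$ if the dynamics hold for all $t\in[0,L-2]$. Data: $u^d:[0,T_d-1]\to\mathbb{R}^m$, $x^d:[0,T_d-1]\to\mathbb{R}^n$, with $T_d\ge(n+m)\tau-1$. $x_{\mathcal{N}_i}$ denotes the stack of the $x_j$, $j\in\mathcal{N}_i$. The local signals are $$w_i^d(t)=\mathrm{col}(u_i^d(t),x^d_{\mathcal{N}_i}(t),x_i^d(t))\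 \text{if } i\in S,\qquad w_i^d(t)=\mathrm{col}(x^d_{\mathcal{N}_i}(t),x_i^d(t))\ \text{if } i\notin S,$$ for $t\in[0,T_d-1]$, and analogously $w_i(t)=\mathrm{col}(u_i(t),x_{\mathcal{N}_i}(t),x_i(t))$ if $i\in S$, $w_i(t)=\mathrm{col}(x_{\mathcal{N}_i}(t),x_i(t))$ if $i\notin S$, for $t\in[0,\tau-1]$. *)

(* Defs.v *)
From HB Require Import structures.
From mathcomp Require Import all_boot all_order all_algebra.
From mathcomp Require Import reals.

Set Implicit Arguments.
Unset Strict Implicit.
Unset Printing Implicit Defensive.

Import GRing.Theory.
Local Open Scope ring_scope.

(* A signal on [0, T - 1] is a function on nat of which only the values at
   t < T are ever used. *)

Section Signals.
Context {R : realType} {k : nat}.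
Implicit Types w : nat -> 'cV[R]_k.

(* col (w 0, ..., w (tau - 1)) *)
Definition sigvec (tau : nat) w : 'cV[R]_(\sum_(a < tau) k) :=
  \mxcol_(a < tau) w a.

(* Hankel matrix with tau block rows of w on [0, T - 1]; the number of columns
   is T - tau + 1 provided tau <= T (truncated subtraction). *)
Definition hankel (T tau : nat) w :
    'M[R]_(\sum_(a < tau) k, (T - tau).+1) :=
  \mxcol_(a < tau) \matrix_(r < k, b < (T - tau).+1) w (a + b)%N r 0.

Definition persistently_exciting (T ord : nat) w : Prop :=
  (ord < T)%N /\ \rank (hankel T ord w) = (k * ord)%N.

End Signals.

(* Every state can be steered to every state in finite time. *)
Definition controllable {R : realType} {n m : nat}
    (A : 'M[R]_n) (B : 'M[R]_(n, m)) : Prop :=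
  forall x0 x1 : 'cV[R]_n,
    exists (T : nat) (u : nat -> 'cV[R]_m) (x : nat -> 'cV[R]_n),
      [/\ x 0%N = x0, x T = x1 &
          forall t, (t < T)%N -> x t.+1 = A *m x t + B *m u t].

(* col (v_i, i \in K), in increasing order of the index i. *)
Definition stack {R : realType} {N : nat} {d : 'I_N -> nat} (K : {set 'I_N})
    (v : forall i, 'cV[R]_(d i)) :
    'cV[R]_(\sum_(k < #|K|) d (enum_val k)) :=
  \mxcol_(k < #|K|) v (enum_val k).

Section Network.
Context {R : realType} {N : nat}.
Variables (e : rel 'I_N) (S : {set 'I_N}) (n_ m_ : 'I_N -> nat).

Definition nbr (i : 'I_N) : {set 'I_N} := [set j | e i j].

(* A i j is only used when j = i or j \in nbr i; B i and the inputs u t i are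
   only used when i \in S. *)
Variables (A : forall i j, 'M[R]_(n_ i, n_ j)).
Variables (B : forall i, 'M[R]_(n_ i, m_ i)).

Definition trajectory (L : nat) (u : nat -> forall i, 'cV[R]_(m_ i))
    (x : nat -> forall i, 'cV[R]_(n_ i)) : Prop :=
  forall t, (t.+1 < L)%N -> forall i,
    x t.+1 i = A i i *m x t i + \sum_(j in nbr i) A i j *m x t j
               + (if i \in S then B i *m u t i else 0).

(* The matrices of the compact form; trajectory_compact checks them against
   the node dynamics. *)
Definition netA : 'M[R]_(\sum_(i < N) n_ i) :=
  \mxblock_(i < N, j < N)
    ((if i == j then A i j else 0) + (if j \in nbr i then A i j else 0)).

(* Block (i, k) is B i if the k-th actuated node is i. The cast performed by
   conform_mx, needed since n_ i and n_ (enum_val k) are then only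
   propositionally equal, is the identity on entries. *)
Definition netB :
    'M[R]_(\sum_(i < N) n_ i, \sum_(k < #|S|) m_ (enum_val k)) :=
  \mxblock_(i < N, k < #|S|)
    (if i == enum_val k then conform_mx 0 (B (enum_val k)) else 0).

Lemma trajectory_compact L u x :
  trajectory L u x <->
  forall t, (t.+1 < L)%N ->
    \mxcol_(i < N) x t.+1 i =
      netA *m \mxcol_(i < N) x t i + netB *m stack S (u t).
Proof.
have step t : netA *m \mxcol_(i < N) x t i + netB *m stack S (u t) =
    \mxcol_(i < N) (A i i *m x t i + \sum_(j in nbr i) A i j *m x t j
               + (if i \in S then B i *m u t i else 0)).
  rewrite /netA /netB /stack !mul_mxblock_mxrow -mxcolD.
  apply: eq_mxcol => i; congr (_ + _).
    under eq_bigr do rewrite mulmxDl.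
    rewrite big_split /=; congr (_ + _).
      rewrite (bigD1 i) //= eqxx big1 ?addr0 // => j /negPf ji.
      by rewrite eq_sym ji mul0mx.
    rewrite [RHS]big_mkcond; apply: eq_bigr => j _.
    by case: ifP => //; rewrite mul0mx.
  rewrite -(big_enum_val (A := mem S)
    (fun j => (if i == j then conform_mx 0 (B j) else 0) *m u t j)).
  case: ifPn => iS.
    rewrite (bigD1 i) //= eqxx conform_mx_id big1 ?addr0 // => j /andP[_ /negPf ji].
    by rewrite eq_sym ji mul0mx.
  rewrite big1 // => j jS; case: eqP => [ij|_]; last by rewrite mul0mx.
  by rewrite ij jS in iS.
split=> H t tL; first by rewrite step; apply: eq_mxcol => i; exact: H.
by move: (H t tL); rewrite step => /eq_mxcolP Hi i; exact: Hi.
Qed.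

End Network.

Section LocalSignals.
Context {R : realType} {N : nat}.
Variables (e : rel 'I_N) (n_ m_ : 'I_N -> nat).
Variables (u : nat -> forall i, 'cV[R]_(m_ i)).
Variables (x : nat -> forall i, 'cV[R]_(n_ i)).

Definition xnbr (i : 'I_N) (t : nat) := stack (nbr e i) (x t).

(* col (u_i, x_{N_i}), for actuated i *)
Definition uxnbr (i : 'I_N) (t : nat) := col_mx (u t i) (xnbr i t).

(* The local signal w_i, for actuated and for unactuated i. *)
Definition wloc_act (i : 'I_N) (t : nat) := col_mx (uxnbr i t) (x t i).

Definition wloc_unact (i : 'I_N) (t : nat) := col_mx (xnbr i t) (x t i).

End LocalSignals.

(* Main.v *)
(** Case (ii) reduces to the same fundamental lemma as case (i): node i is itself
    a linear system with state x_i and with inputs u_i and x_{N_i}, and every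
    xi with xi A_ii^k [B_i, A_{iN_i}] = 0 for all k vanishes, because along every
    global trajectory starting at 0 it satisfies xi x_i = 0.

    For the fundamental lemma, let (xi, h) annihilate all the data columns
    (x(b), v(b), ..., v(b + tau - 1)). Substituting the dynamics yields n
    further annihilators, shifted in time; combining them with the coefficients
    of the characteristic polynomial of A eliminates the state, and persistency
    of excitation of order n + tau makes the combination vanish. Reading off
    its coefficients from the highest one down gives h = 0, then
    xi A^k B = 0 for all k, hence xi = 0. *)
Require Import Defs.
From HB Require Import structures.
From mathcomp Require Import all_boot all_order all_algebra.
From mathcomp Require Import reals zify.

Set Implicit Arguments.
Unset Strict Implicit.
Unset Printing Implicit Defensive.

Local Open Scope ring_scope.

Import GRing.Theory.

(** * Annihilating polynomials and left kernels of Hankel matrices *)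

Lemma monic_annihilator (R : realType) (n : nat) (A : 'M[R]_n) :
  exists c : nat -> R, c n = 1 /\ \sum_(j < n.+1) c j *: A ^+ j = 0.
Proof.
case: n A => [|n] A; first by exists (fun=> 1); split=> //; apply: flatmx0.
exists (fun j => (char_poly A)`_j); split.
  by rewrite -(monicP (char_poly_monic A)) lead_coefE size_char_poly.
transitivity (horner_mx A (char_poly A)); last exact: Cayley_Hamilton.
rewrite -[X in horner_mx A X]coefK poly_def size_char_poly rmorph_sum.
apply: eq_bigr => j _.
by rewrite /= linearZ rmorphXn /= horner_mx_X.
Qed.

Section Hankel.
Context {R : realType} {k : nat}.
Implicit Types w : nat -> 'cV[R]_k.

Lemma mul_hankel T tau w (g : 'cV[R]_((T - tau).+1)) :
  hankel T tau w *m g =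
  sigvec tau (fun a => \sum_(b < (T - tau).+1) g b 0 *: w (a + b)%N).
Proof.
rewrite mxcol_mul; apply: eq_mxcol => a; apply/matrixP => r c.
rewrite ord1 !mxE summxE; apply: eq_bigr => b _.
by rewrite !mxE mulrC.
Qed.

Lemma hankel_mulP T tau w w' (g : 'cV[R]_((T - tau).+1)) :
  hankel T tau w *m g = sigvec tau w' <->
  forall a, (a < tau)%N ->
    w' a = \sum_(b < (T - tau).+1) g b 0 *: w (a + b)%N.
Proof.
rewrite mul_hankel /sigvec -eq_mxcolP.
by split=> [H a aT|H a]; [rewrite -(H (Ordinal aT)) | rewrite H].
Qed.

Lemma mul_mxrow_hankel T tau w (h : nat -> 'rV[R]_k) (b : 'I_(T - tau).+1) :
  ((\mxrow_(a < tau) h a) *m hankel T tau w) 0 b =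
  (\sum_(a < tau) h a *m w (a + b)%N) 0 0.
Proof.
rewrite mul_mxrow_mxcol !summxE; apply: eq_bigr => a _.
by rewrite !mxE; apply: eq_bigr => r _; rewrite !mxE.
Qed.

(** The rank condition is full row rank, so no nonzero row vector, here cut into blocks [h a],
    annihilates every column of the Hankel matrix. *)
Lemma persistently_exciting_left_kernel T ord w (h : nat -> 'rV[R]_k) :
  persistently_exciting T ord w ->
  (forall b, (b <= T - ord)%N -> \sum_(a < ord) h a *m w (a + b)%N = 0) ->
  forall a, (a < ord)%N -> h a = 0.
Proof.
move=> [_ rk] h0 a aord.
have free : row_free (hankel T ord w).
  by rewrite /row_free rk sum_nat_const card_ord mulnC.
have : \mxrow_(a < ord) h a = 0.
  apply: (row_free_inj free); rewrite mul0mx.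
  by apply/rowP => b; rewrite mul_mxrow_hankel h0 ?mxE // -ltnS.
move=> /(congr1 (fun M => submxrow M (Ordinal aord))).
by rewrite mxrowK submxrow0.
Qed.

End Hankel.

(** * The fundamental lemma for a single linear system *)

Section FundamentalLemma.
Context {R : realType} {n p : nat}.
Variables (A : 'M[R]_n) (B : 'M[R]_(n, p)) (T tau : nat).
Variables (x : nat -> 'cV[R]_n) (v : nat -> 'cV[R]_p).
Hypothesis tau_gt0 : (0 < tau)%N.
Hypothesis dyn :
  forall t, (t.+1 < T)%N -> x t.+1 = A *m x t + B *m v t.
Hypothesis pe : persistently_exciting T (n + tau) v.
Hypothesis reach :
  forall xi : 'rV[R]_n, (forall k, xi *m A ^+ k *m B = 0) -> xi = 0.

(* If (xi, h) annihilates the columns of the data matrix, then so does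
   (xi A^j, shifted_row j), by substituting the dynamics j times. *)
Let shifted_row (xi : 'rV[R]_n) (h : nat -> 'rV[R]_p) (j s : nat) : 'rV[R]_p :=
  if (s < j)%N then xi *m A ^+ (j - s.+1) *m B else h (s - j)%N.

(** Induction on [j]: expanding [x b.+1] in the relation for [j] at time [b.+1] puts a new input
    term in front and moves the others up by one. The free bound [K] pads with zeros, so that
    relations for different [j] can be added over a common range. *)
Lemma shifted_left_kernel (xi : 'rV[R]_n) (h : nat -> 'rV[R]_p) :
  (forall a, (tau <= a)%N -> h a = 0) ->
  (forall b, (b <= T - tau)%N ->
     xi *m x b + \sum_(a < tau) h a *m v (a + b)%N = 0) ->
  forall j b K, (b + j <= T - tau)%N -> (j + tau <= K)%N ->
    xi *m A ^+ j *m x b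
    + \sum_(s < K) shifted_row xi h j s *m v (s + b)%N = 0.
Proof.
move=> htail ker; have [ltT _] := pe.
elim=> [|j IHj] b K bT leK.
  rewrite expr0 mulmx1 -[RHS](ker b); last by lia.
  congr (_ + _).
  rewrite (big_ord_widen K (fun a => h a *m v (a + b)%N)) //.
  rewrite [RHS]big_mkcond; apply: eq_bigr => s _.
  rewrite /shifted_row ltn0 subn0; case: ltnP => // les.
  by rewrite htail ?mul0mx.
case: K leK => [|K] leK; first by lia.
rewrite -[RHS](IHj b.+1 K); [|lia|lia].
rewrite big_ord_recl /= dyn; last by lia.
rewrite mulmxDr addrA; congr (_ + _ + _).
- by rewrite exprSr !mulmxA.
- by rewrite /shifted_row ltn0Sn subSS subn0 add0n !mulmxA.
by apply: eq_bigr => s _; rewrite /shifted_row /bump /= add1n ltnS !subSS addSnnS.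
Qed.

Lemma data_left_kernel (xi : 'rV[R]_n) (h : nat -> 'rV[R]_p) :
  (forall a, (tau <= a)%N -> h a = 0) ->
  (forall b, (b <= T - tau)%N ->
     xi *m x b + \sum_(a < tau) h a *m v (a + b)%N = 0) ->
  xi = 0 /\ forall a, h a = 0.
Proof.
move=> htail ker; have [ltT _] := pe.
have [c [cn cA]] := monic_annihilator A.
pose d s := \sum_(j < n.+1) c j *: shifted_row xi h j s.
have d0 : forall s, (s < n + tau)%N -> d s = 0.
  apply: (persistently_exciting_left_kernel pe) => b bT.
  rewrite /d; under eq_bigr do rewrite mulmx_suml.
  rewrite exchange_big /=.
  transitivity (\sum_(j < n.+1) - (c j *: (xi *m A ^+ j *m x b))).
    apply: eq_bigr => j _; have jn := ltn_ord j.
    under eq_bigr do rewrite -scalemxAl.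
    rewrite -scaler_sumr -scalerN; congr (_ *: _); apply/eqP.
    rewrite -addr_eq0 addrC; apply/eqP.
    (* Since [b <= T - (n + tau)] and [j <= n], the last shift still satisfies
       [b + j <= T - tau]. *)
    apply: (shifted_left_kernel htail ker); lia.
  rewrite sumrN.
  under eq_bigr do rewrite scalemxAl scalemxAr.
  by rewrite -mulmx_suml -mulmx_sumr cA mulmx0 mul0mx oppr0.
have h0 : forall a, h a = 0.
  suff hd m : forall a, (tau <= a + m)%N -> h a = 0.
    by move=> a; apply: (hd tau); lia.
  (* Downward induction on [a]: in [d (n + a)] the terms with [j < n] involve [h] only at indices
     above [a], so only [h a] remains. *)
  elim: m => [|m IHm] a am; first by apply: htail; lia.
  have [/htail//|atau] := leqP tau a.
  have := d0 (n + a)%N; rewrite ltn_add2l => /(_ atau).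
  rewrite /d big_ord_recr /= big1 => [|j _].
    by rewrite /shifted_row ltnNge leq_addr /= addKn add0r cn scale1r.
  have jn := ltn_ord j.
  rewrite /shifted_row ltnNge (leq_trans (ltnW jn) (leq_addr _ _)) /=.
  by rewrite IHm ?scaler0 //; lia.
split=> //; apply: reach => k.
elim/ltn_ind: k => k IHk; have [kn|nk] := ltnP k n.
  (* Here [j = n] contributes [xi A^k B], while each [j < n] contributes either a value of [h] or a
     lower power of [A], both already zero. *)
  have := d0 (n - k.+1)%N; rewrite /d big_ord_recr /= big1 => [|j _].
    rewrite /shifted_row cn scale1r add0r ifT; last by lia.
    by rewrite (_ : (n - (n - k.+1).+1)%N = k); [apply; lia | lia].
  have jn := ltn_ord j.
  rewrite /shifted_row; case: ifP => js; last by rewrite h0 scaler0.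
  by rewrite IHk ?scaler0 //; lia.
(* For [k >= n], the annihilating polynomial rewrites [A ^+ k] in terms of strictly lower powers. *)
have -> : A ^+ k = - \sum_(j < n) c j *: A ^+ (k - n + j).
  apply/eqP; rewrite -addr_eq0 addrC; apply/eqP.
  transitivity (A ^+ (k - n) *m \sum_(j < n.+1) c j *: A ^+ j).
    rewrite big_ord_recr /= cn scale1r mulmxDr mulmx_sumr; congr (_ + _).
      by apply: eq_bigr => j _; rewrite -scalemxAr exprD.
    by rewrite -[LHS]/(A ^+ k) -{1}(subnK nk) exprD.
  by rewrite cA mulmx0.
rewrite mulmxN mulNmx mulmx_sumr mulmx_suml big1 ?oppr0 // => j _.
have jn := ltn_ord j.
by rewrite -scalemxAr -scalemxAl IHk ?scaler0 //; lia.
Qed.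

(** The data matrix [M] of states and input windows has full row rank, so some [g] reproduces the
    initial state and the whole input; the dynamics, being linear, then propagate the match to all
    later states. *)
Lemma fundamental_lemma (xs : nat -> 'cV[R]_n) (vs : nat -> 'cV[R]_p) :
  (forall t, (t.+1 < tau)%N -> xs t.+1 = A *m xs t + B *m vs t) ->
  exists g : 'cV[R]_((T - tau).+1), forall a, (a < tau)%N ->
    vs a = \sum_(b < (T - tau).+1) g b 0 *: v (a + b)%N /\
    xs a = \sum_(b < (T - tau).+1) g b 0 *: x (a + b)%N.
Proof.
move=> dyns; have [ltT _] := pe.
pose X := \matrix_(r < n, b < (T - tau).+1) x b r 0.
pose M := col_mx X (hankel T tau v).
have free : row_free M.
  apply: inj_row_free => y; rewrite -[y]hsubmxK mul_row_col.
  set xi := lsubmx y; set y2 := rsubmx y => yM.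
  (* The blocks of [y2], extended by zero from [tau] on as [data_left_kernel] demands. *)
  pose h a : 'rV[R]_p :=
    if insub a is Some i then submxrow y2 (i : 'I_tau) else 0.
  have hE (a : 'I_tau) : h a = submxrow y2 a by rewrite /h valK.
  have y2E : y2 = \mxrow_(a < tau) h a.
    rewrite -[y2 in LHS]submxrowK; apply/eq_mxrowP => a; by rewrite hE.
  have [||-> h0] := @data_left_kernel xi h.
  - by move=> a lea; rewrite /h insubF // ltnNge lea.
  - move=> b; rewrite -ltnS => bT; apply/rowP => i; rewrite ord1.
    move/rowP: yM => /(_ (Ordinal bT)) yM.
    rewrite mxE y2E mul_mxrow_hankel [RHS]mxE in yM.
    rewrite mxE [RHS]mxE -yM; congr (_ + _).
    by rewrite !mxE; apply: eq_bigr => r _; rewrite !mxE.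
  rewrite y2E -row_mx0; congr row_mx.
  by rewrite -[RHS](mxrow0 (q_ := fun=> p)); apply: eq_mxrow => a.
pose g := pinvmx M *m col_mx (xs 0%N) (sigvec tau vs).
have : M *m g = col_mx (xs 0%N) (sigvec tau vs).
  by rewrite mulmxA mulmxVp // mul1mx.
rewrite mul_col_mx => /eq_col_mx[gx /hankel_mulP gv].
exists g; elim=> [|a IHa] aT; split; try exact: gv.
  rewrite -gx; apply/colP => r; rewrite !mxE summxE.
  by apply: eq_bigr => b _; rewrite !mxE mulrC.
have [_ xsa] := IHa (ltnW aT).
rewrite dyns // xsa (gv _ (ltnW aT)) !mulmx_sumr -big_split /=.
apply: eq_bigr => b _; have bT := ltn_ord b.
by rewrite addSn dyn ?scalerDr ?scalemxAr //; lia.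
Qed.

End FundamentalLemma.

(** * Linear combinations of stacked vectors, read block by block *)

Section Stacks.
Context {R : realType}.

Lemma mxcol_lincombP (N c : nat) (d : 'I_N -> nat) (a : 'I_c -> R)
    (v : forall i, 'cV[R]_(d i)) (w : 'I_c -> forall i, 'cV[R]_(d i)) :
  \mxcol_i v i = \sum_b a b *: \mxcol_i w b i <->
  forall i, v i = \sum_b a b *: w b i.
Proof.
have -> : \sum_b a b *: \mxcol_i w b i = \mxcol_i \sum_b a b *: w b i.
  rewrite mxcol_sum; apply: eq_bigr => b _.
  by rewrite -mul_mx_scalar mxcol_mul; apply: eq_mxcol => i; rewrite mul_mx_scalar.
by rewrite -eq_mxcolP.
Qed.

Lemma stack_lincombP (N c : nat) (d : 'I_N -> nat) (K : {set 'I_N})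
    (a : 'I_c -> R) (v : forall i, 'cV[R]_(d i))
    (w : 'I_c -> forall i, 'cV[R]_(d i)) :
  stack K v = \sum_b a b *: stack K (w b) <->
  forall i, i \in K -> v i = \sum_b a b *: w b i.
Proof.
rewrite /stack mxcol_lincombP; split=> H i; last exact: H (enum_valP i).
by move=> iK; move: (H (enum_rank_in iK i)); rewrite enum_rankK_in.
Qed.

Lemma col_mx_lincomb (c d1 d2 : nat) (a : 'I_c -> R) (v1 : 'cV[R]_d1)
    (v2 : 'cV[R]_d2) (w1 : 'I_c -> 'cV[R]_d1) (w2 : 'I_c -> 'cV[R]_d2) :
  v1 = \sum_b a b *: w1 b -> v2 = \sum_b a b *: w2 b ->
  col_mx v1 v2 = \sum_b a b *: col_mx (w1 b) (w2 b).
Proof.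
move=> -> ->; elim/big_ind3: _ => [|x1 y1 z1 x2 y2 z2 <- <-|b _].
- exact: col_mx0.
- by rewrite add_col_mx.
- by rewrite scale_col_mx.
Qed.

End Stacks.

(** * From controllability to the absence of left annihilators *)

(** Steer 0 to the [r]-th basis vector: every [xi A^k x] stays 0 on the way, so the [r]-th entry of
    [xi] is 0. *)
Lemma controllable_left_annihilator (R : realType) (n m : nat) (A : 'M[R]_n)
    (B : 'M[R]_(n, m)) (xi : 'rV[R]_n) :
  controllable A B -> (forall k, xi *m A ^+ k *m B = 0) -> xi = 0.
Proof.
move=> ctrl xiAB; apply/rowP => r.
have [T [u [x [x0 xT dyn]]]] := ctrl 0 (delta_mx r 0).
have xt t : (t <= T)%N -> forall k, xi *m A ^+ k *m x t = 0.
  elim: t => [|t IHt] tT k; first by rewrite x0 mulmx0.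
  rewrite dyn // mulmxDr !mulmxA xiAB mul0mx addr0.
  by rewrite -[xi *m _ *m A]mulmxA -[_ *m A]/(A ^+ k * A) -exprSr (IHt (ltnW tT)).
have := xt T (leqnn T) 0%N; rewrite xT expr0 mulmx1 -colE.
by move/rowP/(_ 0); rewrite !mxE.
Qed.

Section LocalSystem.
Context {R : realType} {N : nat}.
Variables (e : rel 'I_N) (S : {set 'I_N}) (n_ m_ : 'I_N -> nat).
Variables (A : forall i j, 'M[R]_(n_ i, n_ j)).
Variables (B : forall i, 'M[R]_(n_ i, m_ i)).

Definition Anbr (i : 'I_N) := \mxrow_(k < #|nbr e i|) A i (enum_val k).

Lemma mul_Anbr_stack i (y : forall j, 'cV[R]_(n_ j)) :
  Anbr i *m stack (nbr e i) y = \sum_(j in nbr e i) A i j *m y j.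
Proof.
rewrite mul_mxrow_mxcol.
by rewrite -(big_enum_val (A := mem (nbr e i)) (fun j => A i j *m y j)).
Qed.

Lemma mul_Anbr_eq0 i (y : 'rV[R]_(n_ i)) :
  y *m Anbr i = 0 -> forall j, j \in nbr e i -> y *m A i j = 0.
Proof.
move=> yA j ji.
have yAk k : y *m A i (enum_val (k : 'I_#|nbr e i|)) = 0.
  by move/(congr1 (fun M => submxrow M k)): yA; rewrite mul_mxrow mxrowK submxrow0.
by move: (yAk (enum_rank_in ji j)); rewrite enum_rankK_in.
Qed.

(* Along any global trajectory from 0, the output xi A_ii^k x_i stays 0,
   since xi A_ii^k kills every signal entering node i from outside. *)
Lemma local_left_annihilator i (xi : 'rV[R]_(n_ i)) :
  controllable (netA e A) (netB S B) ->
  (forall k, xi *m A i i ^+ k *m Anbr i = 0) ->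
  (i \in S -> forall k, xi *m A i i ^+ k *m B i = 0) -> xi = 0.
Proof.
move=> ctrl xiA xiB; apply/rowP => r.
(* The target is the [r]-th basis vector in block [i] and 0 in every other block. *)
have [T [u [x [x0 xT dyn]]]] :=
  ctrl 0 (\mxcol_j (if j == i then conform_mx 0 (delta_mx r 0 : 'cV[R]_(n_ i))
                    else 0)).
have xt t : (t <= T)%N -> forall k, xi *m A i i ^+ k *m submxcol (x t) i = 0.
  elim: t => [|t IHt] tT k; first by rewrite x0 submxcol0 mulmx0.
  rewrite dyn // submxcolD -[x t]submxcolK -[u t]submxcolK.
  rewrite !mul_mxblock_mxrow !mxcolK mulmxDr !mulmx_sumr.
  rewrite (bigD1 i) //= !big1 => [|l _|j /negPf ji].
  - rewrite !addr0 eqxx mulmxDl mulmxDr mulmxA.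
    rewrite -[xi *m _ *m A i i]mulmxA -[_ *m A i i]/(A i i ^+ k * A i i) -exprSr.
    (* With a self-loop at [i], the diagonal block contains [A i i] a second time, as a neighbour
       term; that copy is a block of [Anbr i] and is killed as such. *)
    rewrite (IHt (ltnW tT)) add0r; case: ifP => [ii|_]; last by rewrite mul0mx mulmx0.
    by rewrite mulmxA (mul_Anbr_eq0 (xiA k)) ?mul0mx.
  - rewrite mulmxA (_ : _ *m (if _ then _ else _) = 0) ?mul0mx //.
    case: eqP (enum_valP l) => [<- iS|_ _]; last exact: mulmx0.
    by rewrite conform_mx_id xiB.
  - rewrite eq_sym ji add0r mulmxA; case: ifP => [jn|_].
      by rewrite (mul_Anbr_eq0 (xiA k)) ?mul0mx.
    by rewrite mulmx0 mul0mx.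
have := xt T (leqnn T) 0%N.
rewrite xT mxcolK eqxx conform_mx_id expr0 mulmx1 -colE.
by move/rowP/(_ 0); rewrite !mxE.
Qed.

End LocalSystem.

Theorem mainTheorem2 (R : realType) (N : nat)
    (e : rel 'I_N) (he : symmetric e) (S : {set 'I_N})
    (n_ m_ : 'I_N -> nat)
    (A : forall i j, 'M[R]_(n_ i, n_ j)) (B : forall i, 'M[R]_(n_ i, m_ i))
    (n m : nat) (hn : n = (\sum_(i < N) n_ i)%N)
    (hm : m = (\sum_(i in S) m_ i)%N)
    (tau Td : nat) (hTd : ((n + m) * tau - 1 <= Td)%N)
    (ud : nat -> forall i, 'cV[R]_(m_ i))
    (xd : nat -> forall i, 'cV[R]_(n_ i))
    (hctrl : controllable (netA e A) (netB S B))
    (hdata : trajectory e S A B Td ud xd)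
    (hpe : persistently_exciting Td (n + tau) (fun t => stack S (ud t)) \/
      ((forall i, i \in S ->
          persistently_exciting Td (n_ i + tau) (uxnbr e ud xd i)) /\
       (forall i, i \notin S ->
          persistently_exciting Td (n_ i + tau) (xnbr e xd i)))) :
  forall (u : nat -> forall i, 'cV[R]_(m_ i))
         (x : nat -> forall i, 'cV[R]_(n_ i)),
    trajectory e S A B tau u x ->
    (forall i, i \in S -> exists g : 'cV[R]_((Td - tau).+1),
       hankel Td tau (wloc_act e ud xd i) *m g
       = sigvec tau (wloc_act e u x i)) /\
    (forall i, i \notin S -> exists g : 'cV[R]_((Td - tau).+1),
       hankel Td tau (wloc_unact e xd i) *m g
       = sigvec tau (wloc_unact e x i)).
Proof.
subst n; move=> u x htraj.
have [tau0|tau_gt0] := posnP tau.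
  by rewrite tau0; split=> i _; exists 0; apply/hankel_mulP.
(* In case (i) one [g], obtained for the whole network, serves every node; in case (ii) each node
   gets its own. *)
case: hpe => [pe|[pe_act pe_unact]].
  have /trajectory_compact hdata' := hdata.
  have /trajectory_compact htraj' := htraj.
  have reach xi := controllable_left_annihilator (xi := xi) hctrl.
  have [g Hg] := fundamental_lemma tau_gt0 hdata' pe reach htraj'.
  have gx a i : (a < tau)%N ->
      x a i = \sum_(b < (Td - tau).+1) g b 0 *: xd (a + b)%N i.
    by move=> /Hg[_ /mxcol_lincombP]; apply.
  have gnbr a i : (a < tau)%N ->
      xnbr e x i a = \sum_(b < (Td - tau).+1) g b 0 *: xnbr e xd i (a + b)%N.
    by move=> aT; apply/stack_lincombP => j _; apply: gx.
  split=> i iS; exists g; apply/hankel_mulP => a aT.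
    have gu : u a i = \sum_(b < (Td - tau).+1) g b 0 *: ud (a + b)%N i.
      by have [/stack_lincombP/(_ i iS)] := Hg a aT.
    by apply: col_mx_lincomb (gx _ _ aT); apply: col_mx_lincomb (gnbr _ _ aT).
  by apply: col_mx_lincomb; [apply: gnbr | apply: gx].
split=> i iS.
  have dyn_act L u' x' : trajectory e S A B L u' x' ->
      forall t, (t.+1 < L)%N -> x' t.+1 i =
        A i i *m x' t i + row_mx (B i) (Anbr e A i) *m uxnbr e u' x' i t.
    move=> tr t tL; rewrite tr // iS mul_row_col mul_Anbr_stack.
    (* [uxnbr] lists the input before the neighbours, the node dynamics the other way round. *)
    by rewrite -addrA [X in _ + X]addrC.
  have reach (xi : 'rV_(n_ i)) :
      (forall k, xi *m A i i ^+ k *m row_mx (B i) (Anbr e A i) = 0) -> xi = 0.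
    move=> H.
    apply: (local_left_annihilator hctrl) => [k|_ k]; have := H k;
      by rewrite mul_mx_row => /eqP; rewrite row_mx_eq0 => /andP[/eqP ? /eqP ?].
  have [g Hg] := fundamental_lemma tau_gt0 (dyn_act _ _ _ hdata)
    (pe_act i iS) reach (dyn_act _ _ _ htraj).
  exists g; apply/hankel_mulP => a /Hg[gv gx].
  exact: col_mx_lincomb.
have dyn_unact L u' x' : trajectory e S A B L u' x' ->
    forall t, (t.+1 < L)%N -> x' t.+1 i =
      A i i *m x' t i + Anbr e A i *m xnbr e x' i t.
  by move=> tr t tL; rewrite tr // (negPf iS) addr0 mul_Anbr_stack.
have reach (xi : 'rV_(n_ i)) :
    (forall k, xi *m A i i ^+ k *m Anbr e A i = 0) -> xi = 0.
  by move=> H; apply: (local_left_annihilator hctrl) => //; rewrite (negPf iS).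
have [g Hg] := fundamental_lemma tau_gt0 (dyn_unact _ _ _ hdata)
  (pe_unact i iS) reach (dyn_unact _ _ _ htraj).
exists g; apply/hankel_mulP => a /Hg[gv gx].
exact: col_mx_lincomb.
Qed.
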